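(* Let $G$ be an abelian group. Let $\mathcal{H}$ and $\mathcal{H}'$ be two hypergraphs such that for any $\sigma\in\mathcal{H}$ and any $\sigma'\in\mathcal{H}'$, either $\sigma\cap\sigma'$ is empty or $\sigma\cap\sigma'\in\mathcal{H}\cap\mathcal{H}'$. Then there is a long exact sequence of embedded homology (with coefficients in $G$) $$\cdots\longrightarrow H_n(\mathcal{H}\cap\mathcal{H}')\longrightarrow H_n(\mathcal{H})\oplus H_n(\mathcal{H}')\longrightarrow H_n(\mathcal{H}\cup\mathcal{H}')\longrightarrow H_{n-1}(\mathcal{H}\cap\mathcal{H}')\longrightarrow\cdots.$$
   Context: All hypergraphs live on finite totally ordered vertex sets; $\mathcal{H}$ and $\mathcal{H}'$ are on subsets of a common finite totally ordered set. A hypergraph $\mathcal{H}$ is a set of non-empty subsets (called hyperedges) of its vertex set $V_{\mathcal{H}}$, where $V_{\mathcal{H}}$ is the union of the hyperedges. Unions and intersections of hypergraphs are unions and intersections of their sets of hyperedges. An $n$-hyperedge is a hyperedge with $n+1$ elements, and $\mathcal{H}_n$ is the set of $n$-hyperedges. A simplicial complex is a hypergraph closed under taking non-empty subsets of hyperedges. The associated simplicial complex $K_{\mathcal{H}}$ consists of all non-empty subsets of hyperedges of $\mathcal{H}$. For a finite set $S$, $G(S)$ is the group of formal linear combinations of elements of $S$ with coefficients in $G$ ($G(\emptyset)=0$). For a simplicial complex $K$, the groups $G(K_n)$, $n\ge 0$, form a chain complex with boundary $\partial_n\{v_0\prec\cdots\prec v_n\}=\sum_{i=0}^n(-1)^i\{v_0,\ldots,\hat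 v_i,\ldots,v_n\}$ for $n\geq 1$ and $\partial_0=0$. For a graded subgroup $D_*$ of a chain complex $C_*$, the infimum chain complex is $\mathrm{Inf}_n(D_*,C_* )=\sum\{C'_n\mid C'_* \text{ a subchain complex of } C_* \text{ with } C'_k\subseteq D_k \text{ for all } k\}$. Put $\mathrm{Inf}_*(\mathcal{H})=\mathrm{Inf}_*(G(\mathcal{H}_* ),G((K_{\mathcal{H}})_* ))$. The $n$-th embedded homology of $\mathcal{H}$ (with coefficients in $G$) is $H_n(\mathcal{H})=H_n(\mathrm{Inf}_*(\mathcal{H}))$. The long exact sequence is the Mayer-Vietoris sequence: the map $H_n(\mathcal{H}\cap\mathcal{H}')\to H_n(\mathcal{H})\oplus H_n(\mathcal{H}')$ is induced by the inclusions (with a sign on one component) and the map $H_n(\mathcal{H})\oplus H_n(\mathcal{H}')\to H_n(\mathcal{H}\cup\mathcal{H}')$ is induced by the sum of the inclusions. *)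

(* Defs.v *)
From HB Require Import structures.
From mathcomp Require Import all_boot all_order all_algebra.
From mathcomp Require Import boolp.

Set Implicit Arguments.
Unset Strict Implicit.
Unset Printing Implicit Defensive.

Import Order.TTheory GRing.Theory.
Local Open Scope ring_scope.
Local Open Scope quotient_scope.

Record subgroup (A : zmodType) (P : zmodClosed A) :=
  Subgroup { subgroup_val :> A; subgroup_valP : subgroup_val \in P }.

HB.instance Definition _ A P := [isSub for @subgroup_val A P].
HB.instance Definition _ A P := [Choice of @subgroup A P by <:].
HB.instance Definition _ A P := [SubChoice_isSubZmodule of @subgroup A P by <:].

Section Restriction.
Variables (A B : zmodType) (f : {additive A -> B}).
Variables (P : zmodClosed A) (Q : zmodClosed B).
Hypothesis fPQ : forall x, x \in P -> f x \in Q.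

Definition restr_fun (x : subgroup P) : subgroup Q :=
  Subgroup (fPQ (subgroup_valP x)).

Fact restr_fun_zmod_morphism : zmod_morphism restr_fun.
Proof. by move=> x y; apply: val_inj; rewrite /= !raddfB. Qed.

HB.instance Definition _ :=
  GRing.isZmodMorphism.Build _ _ restr_fun restr_fun_zmod_morphism.

Definition restr : {additive subgroup P -> subgroup Q} := restr_fun.
End Restriction.

Definition exact_at (A B C : zmodType) (f : A -> B) (g : B -> C) : Prop :=
  forall y, g y = 0 <-> exists x, f x = y.

(* Concentrated in degrees >= 0; [diff C n] is the boundary from degree n+1
   to degree n, the boundary out of degree 0 being zero. *)
Record chainComplex := ChainComplex {
  chain :> nat -> zmodType;
  diff : forall n, {additive chain n.+1 -> chain n};
  diffK : forall n x, diff n (diff n.+1 x) = 0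
}.

Record chainMap (C D : chainComplex) := ChainMap {
  chain_map :> forall n, {additive C n -> D n};
  chain_mapE : forall n x, chain_map n (diff C n x) = diff D n (chain_map n.+1 x)
}.

Section Homology.
Variable C : chainComplex.

Definition cycle_pred n : {pred C n} :=
  match n return pred (C n) with
  | 0%N => fun=> true
  | m.+1 => fun x => diff C m x == 0
  end.

Fact cycle_pred_zmod_closed n : zmod_closed (@cycle_pred n).
Proof.
case: n => [|n]; first by split.
split=> [|x y]; rewrite !unfold_in /= ?raddf0 //.
by rewrite raddfB => /eqP-> /eqP->; rewrite subr0.
Qed.

HB.instance Definition _ n :=
  GRing.isZmodClosed.Build (C n) (@cycle_pred n) (cycle_pred_zmod_closed n).

Definition cycles n := subgroup (@cycle_pred n : zmodClosed (C n)).

Definition boundary_pred n : {pred cycles n} :=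
  [pred z | `[< exists y, diff C n y = val z >]].

Fact boundary_pred_zmod_closed n : zmod_closed (@boundary_pred n).
Proof.
split=> [|x y]; rewrite !unfold_in /=.
  by apply/asboolP; exists 0; rewrite raddf0.
move=> /asboolP[u ux] /asboolP[v vy]; apply/asboolP.
by exists (u - v); rewrite raddfB ux vy.
Qed.

HB.instance Definition _ n := GRing.isZmodClosed.Build (cycles n)
  (@boundary_pred n) (boundary_pred_zmod_closed n).

Definition boundaries n : zmodClosed (cycles n) := @boundary_pred n.

Definition homology n := Quotient.quot (boundaries n).
HB.instance Definition _ n := GRing.Zmodule.on (homology n).

Definition homology_class n (z : cycles n) : homology n :=
  \pi_(Quotient.quot (boundaries n)) z.
End Homology.

Section HomologyMap.
Variables (C D : chainComplex) (f : chainMap C D) (n : nat).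

Fact chain_map_cycle x : x \in @cycle_pred C n -> f n x \in @cycle_pred D n.
Proof.
case: n x => [//|m] x; rewrite !unfold_in /= => /eqP dx.
by rewrite -chain_mapE dx raddf0.
Qed.

Definition cycle_map : {additive cycles C n -> cycles D n} :=
  restr chain_map_cycle.

(* The class of a representative of the argument; [homology_mapE] shows that
   the choice of representative is irrelevant. *)
Definition homology_fun (x : homology C n) : homology D n :=
  homology_class (cycle_map (repr x)).

Fact homology_mapE z :
  homology_fun (homology_class z) = homology_class (cycle_map z).
Proof.
apply/eqP; rewrite /homology_fun /homology_class -Quotient.idealrBE -raddfB.
have : repr (homology_class z) - z \in boundaries C n.
  by rewrite Quotient.idealrBE reprK.
rewrite !unfold_in /= => /asboolP[y yz]; apply/asboolP.
by exists (f n.+1 y); rewrite -chain_mapE yz.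
Qed.

Fact homology_fun_zmod_morphism : zmod_morphism homology_fun.
Proof.
move=> x y; rewrite -[x]reprK -[y]reprK -raddfB.
rewrite -!/(homology_class _) !homology_mapE raddfB.
by rewrite /homology_class raddfB.
Qed.

HB.instance Definition _ := GRing.isZmodMorphism.Build
  (homology C n) (homology D n) homology_fun homology_fun_zmod_morphism.

Definition homology_map : {additive homology C n -> homology D n} :=
  homology_fun.
End HomologyMap.

Definition gradedSubgroup (C : chainComplex) := forall n, zmodClosed (C n).

Definition graded_sub (C : chainComplex) (E D : gradedSubgroup C) : Prop :=
  forall n x, x \in E n -> x \in D n.

Definition is_subcomplex (C : chainComplex) (E : gradedSubgroup C) : Prop :=
  forall n x, x \in E n.+1 -> diff C n x \in E n.

Section Infimum.
Variables (C : chainComplex) (D : gradedSubgroup C).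

(* The sum of a family of subgroups consists of the finite sums of elements,
   each taken from some member of the family. *)
Definition inf_pred n : {pred C n} :=
  [pred x | `[< exists2 s : seq (C n),
     (forall y, y \in s -> exists E : gradedSubgroup C,
        [/\ is_subcomplex E, graded_sub E D & y \in E n]) &
     x = \sum_(y <- s) y >]].

Fact inf_pred_zmod_closed n : zmod_closed (@inf_pred n).
Proof.
split=> [|x y]; rewrite !unfold_in /=.
  by apply/asboolP; exists [::]; rewrite ?big_nil.
move=> /asboolP[s sP ->] /asboolP[t tP ->]; apply/asboolP.
exists (s ++ map -%R t); last by rewrite big_cat big_map sumrN.
move=> z; rewrite mem_cat => /orP[/sP//|/mapP[u /tP[E [E1 E2 uE]] ->]].
by exists E; split; rewrite ?rpredN.
Qed.

HB.instance Definition _ n :=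
  GRing.isZmodClosed.Build (C n) (@inf_pred n) (inf_pred_zmod_closed n).

Definition infimum : gradedSubgroup C := fun n => @inf_pred n.

Fact infimum_diff : is_subcomplex infimum.
Proof.
move=> n x; rewrite !unfold_in /= => /asboolP[s sP ->]; apply/asboolP.
exists (map (diff C n) s); last by rewrite big_map raddf_sum.
move=> _ /mapP[u /sP[E [E1 E2 uE]] ->].
by exists E; split=> //; apply: E1.
Qed.

Definition inf_diff n : {additive subgroup (infimum n.+1) -> subgroup (infimum n)} :=
  restr (@infimum_diff n).

Fact inf_diffK n x : inf_diff n (inf_diff n.+1 x) = 0.
Proof. by apply: val_inj; rewrite /= diffK. Qed.

Definition infComplex : chainComplex :=
  @ChainComplex (fun n => subgroup (infimum n)) inf_diff inf_diffK.
End Infimum.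

Section InfimumMap.
Variables (C C' : chainComplex) (f : chainMap C C').
Variables (D : gradedSubgroup C) (D' : gradedSubgroup C').
Hypothesis fD : forall n x, x \in D n -> f n x \in D' n.

Section Image.
Variables (E : gradedSubgroup C) (n : nat).

Definition image_pred : {pred C' n} :=
  [pred y | `[< exists2 x, x \in E n & f n x = y >]].

Fact image_pred_zmod_closed : zmod_closed image_pred.
Proof.
split=> [|x y]; rewrite !unfold_in /=.
  by apply/asboolP; exists 0; rewrite ?raddf0 ?rpred0.
move=> /asboolP[u uE <-] /asboolP[v vE <-]; apply/asboolP.
by exists (u - v); rewrite ?raddfB ?rpredB.
Qed.

HB.instance Definition _ :=
  GRing.isZmodClosed.Build (C' n) image_pred image_pred_zmod_closed.
End Image.

Definition image_sub (E : gradedSubgroup C) : gradedSubgroup C' :=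
  fun n => @image_pred E n.

Fact inf_map_subproof n x : x \in infimum D n -> f n x \in infimum D' n.
Proof.
rewrite !unfold_in /= => /asboolP[s sP ->]; apply/asboolP.
exists (map (f n) s); last by rewrite big_map raddf_sum.
move=> _ /mapP[u /sP[E [E1 E2 uE]] ->].
exists (image_sub E); split.
- move=> k _ /asboolP[v vE <-]; apply/asboolP.
  by exists (diff C k v); [apply: E1|rewrite chain_mapE].
- by move=> k _ /asboolP[v vE <-]; apply: fD; apply: E2.
- by apply/asboolP; exists u.
Qed.

Definition inf_map_fun n : {additive infComplex D n -> infComplex D' n} :=
  restr (@inf_map_subproof n).

Fact inf_map_funE n x :
  inf_map_fun n (diff (infComplex D) n x) =
  diff (infComplex D') n (inf_map_fun n.+1 x).
Proof. by apply: val_inj; rewrite /= chain_mapE. Qed.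

Definition inf_map : chainMap (infComplex D) (infComplex D') :=
  ChainMap inf_map_funE.
End InfimumMap.

Section Formal.
Variables (T : finType) (G : zmodType).

(* The group G(S), realised inside the functions on all of T. *)
Definition formal_pred (S : {set T}) : {pred {ffun T -> G}} :=
  [pred c : {ffun T -> G} | [forall x, (c x != 0) ==> (x \in S)]].

Fact formalP (S : {set T}) (c : {ffun T -> G}) :
  reflect (forall x, x \notin S -> c x = 0) (c \in formal_pred S).
Proof.
apply: (iffP forallP) => cS x; last first.
  by apply/implyP; apply: contraR => /cS->.
by move=> xS; apply/eqP; apply: contraNT xS => cx; have /implyP := cS x; apply.
Qed.

Fact formal_pred_zmod_closed S : zmod_closed (formal_pred S).
Proof.
split=> [|c e]; first by apply/formalP => x _; rewrite ffunE.
move=> /formalP cS /formalP eS; apply/formalP => x xS.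
by rewrite !ffunE cS ?eS ?subr0.
Qed.

HB.instance Definition _ S := GRing.isZmodClosed.Build {ffun T -> G}
  (formal_pred S) (formal_pred_zmod_closed S).

Definition formal_closed (S : {set T}) : zmodClosed {ffun T -> G} := formal_pred S.
Definition formal (S : {set T}) := subgroup (formal_closed S).

(* g times the basis element x *)
Definition single (x : T) (g : G) : {ffun T -> G} :=
  [ffun y => if y == x then g else 0].

Fact singleB x g h : single x (g - h) = single x g - single x h.
Proof. by apply/ffunP => y; rewrite !ffunE; case: eqP; rewrite ?subr0. Qed.

Fact single0 x : single x 0 = 0.
Proof. by apply/ffunP => y; rewrite !ffunE if_same. Qed.

Fact singleD x g h : single x (g + h) = single x g + single x h.
Proof. by apply/ffunP => y; rewrite !ffunE; case: eqP; rewrite ?addr0. Qed.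
End Formal.

Section Boundary.
Variables (d : Order.disp_t) (V : finOrderType d) (G : zmodType).
Implicit Types (s : {set V}) (c : {ffun {set V} -> G}).

(* If s = {v_0 < ... < v_n} then [vindex s v_i] is i. *)
Definition vindex s (v : V) : nat := #|[set u in s | (u < v)%O]|.

(* The formula for the boundary, for chains of any degree; only its
   restriction to chains of positive degree is used, so no empty face occurs. *)
Definition bd_fun c : {ffun {set V} -> G} :=
  \sum_(s : {set V}) \sum_(v in s) single (s :\ v) (c s *~ (-1) ^+ vindex s v).

Fact bd_fun_zmod_morphism : zmod_morphism bd_fun.
Proof.
move=> c e; rewrite /bd_fun -sumrB; apply: eq_bigr => s _.
rewrite -sumrB; apply: eq_bigr => v _.
by rewrite !ffunE mulrzBl singleB.
Qed.

HB.instance Definition _ := GRing.isZmodMorphism.Build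
  {ffun {set V} -> G} {ffun {set V} -> G} bd_fun bd_fun_zmod_morphism.

Definition bd : {additive {ffun {set V} -> G} -> {ffun {set V} -> G}} := bd_fun.

Fact bd_single s g :
  bd (single s g) =
  \sum_(v in s) single (s :\ v) (g *~ (-1) ^+ vindex s v).
Proof.
rewrite /bd /= /bd_fun (bigD1 s) //= [X in _ + X]big1 ?addr0.
  by apply: eq_bigr => v _; rewrite ffunE eqxx.
move=> t ts; apply: big1 => v _.
by rewrite ffunE (negPf ts) mul0rz single0.
Qed.

Fact vindexD1_lt s v w : (v < w)%O -> vindex (s :\ w) v = vindex s v.
Proof.
move=> vw; apply: eq_card => u; rewrite !inE.
by have [->|//] := eqVneq u w; rewrite (lt_gtF vw) !andbF.
Qed.

Fact vindexD1_gt s v w :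
  v \in s -> (v < w)%O -> vindex s w = (vindex (s :\ v) w).+1.
Proof.
move=> vs vw; rewrite /vindex (cardsD1 v) inE vs vw add1n; congr _.+1.
by apply: eq_card => u; rewrite !inE andbA.
Qed.

Fact bdK c : bd (bd c) = 0.
Proof.
rewrite [bd c]/(bd_fun c) /bd_fun raddf_sum big1 // => s _.
rewrite raddf_sum /=.
pose F v w := single (s :\ v :\ w)
  (c s *~ (-1) ^+ vindex s v *~ (-1) ^+ vindex (s :\ v) w).
have FN v w : v \in s -> (v < w)%O -> F v w + F w v = 0.
  move=> vs vw; rewrite /F (setDDl s [set w]) setUC -setDDl -singleD.
  rewrite (vindexD1_lt _ vw) (vindexD1_gt vs vw) -!mulrzA -mulrzDr exprS.
  by rewrite mulN1r mulNr [X in _ - X]mulrC subrr mulr0z single0.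
rewrite (eq_bigr (fun v => \sum_(w in s | (w < v)%O) F v w +
                           \sum_(w in s | (v < w)%O) F v w)); last first.
  move=> v vs; rewrite -[LHS]/(bd _) bd_single.
  rewrite (bigID (fun w => (w < v)%O)) /=; congr (_ + _); apply: eq_bigl => w.
    by rewrite !inE; case: (ltgtP w v); rewrite ?andbF ?andbT.
  by rewrite !inE; case: (ltgtP w v); rewrite ?andbF ?andbT.
rewrite big_split /= (exchange_big_dep (mem s)) /=; last by move=> ? ? ? /andP[].
rewrite -big_split /= big1 // => v vs.
rewrite [X in X + _](eq_bigl (fun w => (w \in s) && (v < w)%O)); last first.
  by move=> w; rewrite vs.
by rewrite -big_split big1 //= => w /andP[_ vw]; rewrite addrC FN.
Qed.
End Boundary.

(* The vertex set of a hypergraph is the union of its hyperedges; it is a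
   subset of the ambient finite totally ordered set V. *)
Section Hypergraph.
Variables (d : Order.disp_t) (V : finOrderType d).

Record hypergraph := Hypergraph {
  hyperedges :> {set {set V}};
  hyperedges_neq0 : set0 \notin hyperedges
}.

Record simplicialComplex := SimplicialComplex {
  simplices :> hypergraph;
  simplices_closed : forall s t : {set V},
    s \in hyperedges simplices -> t \subset s -> t != set0 ->
    t \in hyperedges simplices
}.

Fact hgI_subproof (H H' : hypergraph) : set0 \notin H :&: H'.
Proof. by rewrite inE negb_and hyperedges_neq0. Qed.

Definition hgI (H H' : hypergraph) : hypergraph := Hypergraph (hgI_subproof H H').

Fact hgU_subproof (H H' : hypergraph) : set0 \notin H :|: H'.
Proof. by rewrite inE negb_or !hyperedges_neq0. Qed.

Definition hgU (H H' : hypergraph) : hypergraph := Hypergraph (hgU_subproof H H').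

Definition nhyperedges (H : hypergraph) (n : nat) : {set {set V}} :=
  [set s in hyperedges H | #|s| == n.+1].

Section Associated.
Variable H : hypergraph.

Definition assoc_simplices : {set {set V}} :=
  [set s | (s != set0) && [exists t in hyperedges H, s \subset t]].

Fact assoc_simplices_neq0 : set0 \notin assoc_simplices.
Proof. by rewrite inE eqxx. Qed.

Fact assoc_simplices_closed (s t : {set V}) :
  s \in assoc_simplices -> t \subset s -> t != set0 -> t \in assoc_simplices.
Proof.
rewrite !inE => /andP[_ /exists_inP[u uH su]] ts ->.
by apply/exists_inP; exists u => //; apply: subset_trans su.
Qed.

Definition assoc_complex : simplicialComplex :=
  @SimplicialComplex (Hypergraph assoc_simplices_neq0) assoc_simplices_closed.

Fact hyperedges_assoc : H \subset assoc_complex.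
Proof.
apply/subsetP => s sH; rewrite inE; apply/andP; split.
  by apply: contraTneq sH => ->; apply: hyperedges_neq0.
by apply/exists_inP; exists s.
Qed.
End Associated.

Fact assoc_complexS (H L : hypergraph) :
  H \subset L -> assoc_complex H \subset assoc_complex L.
Proof.
move=> /subsetP HL; apply/subsetP => s.
rewrite !inE => /andP[-> /exists_inP[t /HL tL st]].
by apply/exists_inP; exists t.
Qed.
End Hypergraph.

Section SimplicialChains.
Variables (d : Order.disp_t) (V : finOrderType d) (G : zmodType).

Section Complex.
Variable K : simplicialComplex V.

Fact bd_simplices n c :
  c \in formal_closed G (nhyperedges K n.+1) ->
  bd V G c \in formal_closed G (nhyperedges K n).
Proof.
move=> /formalP cK; apply/formalP => t tK.
rewrite /bd /= /bd_fun sum_ffunE big1 // => s _.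
rewrite sum_ffunE big1 // => v vs; rewrite ffunE.
case: eqP => // ts; rewrite cK ?mul0rz //.
apply: contra tK; rewrite !inE => /andP[sK /eqP sn].
have tn : #|t| = n.+1 by move: sn; rewrite ts (cardsD1 v) vs => -[].
rewrite tn eqxx andbT; apply: simplices_closed sK _ _.
  by rewrite ts subsetDl.
by rewrite -card_gt0 tn.
Qed.

Definition simplicial_diff n :
    {additive formal G (nhyperedges K n.+1) -> formal G (nhyperedges K n)} :=
  restr (@bd_simplices n).

Fact simplicial_diffK n x : simplicial_diff n (simplicial_diff n.+1 x) = 0.
Proof. by apply: val_inj; apply: bdK. Qed.

Definition simplicialChains : chainComplex :=
  @ChainComplex (fun n => formal G (nhyperedges K n))
    simplicial_diff simplicial_diffK.
End Complex.

Section Inclusion.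
Variables (K L : simplicialComplex V) (KL : K \subset L).

Fact simplicial_inclusion_subproof n c :
  c \in formal_closed G (nhyperedges K n) ->
  idfun c \in formal_closed G (nhyperedges L n).
Proof.
move=> /formalP cK; apply/formalP => s sL; apply: cK; apply: contra sL.
by rewrite !inE => /andP[/(subsetP KL)-> ->].
Qed.

Definition simplicial_inclusion_fun n :
    {additive simplicialChains K n -> simplicialChains L n} :=
  restr (@simplicial_inclusion_subproof n).

Fact simplicial_inclusion_funE n x :
  simplicial_inclusion_fun n (diff (simplicialChains K) n x) =
  diff (simplicialChains L) n (simplicial_inclusion_fun n.+1 x).
Proof. exact: val_inj. Qed.

Definition simplicial_inclusion :
    chainMap (simplicialChains K) (simplicialChains L) :=
  ChainMap simplicial_inclusion_funE.
End Inclusion.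
End SimplicialChains.

Section EmbeddedHomology.
Variables (d : Order.disp_t) (V : finOrderType d) (G : zmodType).
Implicit Types H L : hypergraph V.

(* G(H_n) as a subgroup of G((K_H)_n); nothing is lost by intersecting with
   the latter, by [hyperedges_assoc]. *)
Section Graded.
Variables (H : hypergraph V) (n : nat).

Definition hchain_pred : {pred simplicialChains G (assoc_complex H) n} :=
  [pred c | val c \in formal_closed G (nhyperedges H n)].

Fact hchain_pred_zmod_closed : zmod_closed hchain_pred.
Proof.
split=> [|x y xH yH].
  exact: (rpred0 (formal_closed G (nhyperedges H n))).
exact: (@rpredB _ (formal_closed G (nhyperedges H n)) _ _ xH yH).
Qed.

HB.instance Definition _ := GRing.isZmodClosed.Build
  (simplicialChains G (assoc_complex H) n) hchain_pred hchain_pred_zmod_closed.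
End Graded.

Definition hchains H : gradedSubgroup (simplicialChains G (assoc_complex H)) :=
  fun n => @hchain_pred H n.

Definition embInf H : chainComplex := infComplex (hchains H).

Definition embHomology H n : zmodType := homology (embInf H) n.

Fact emb_inclusion_subproof H L (HL : H \subset L) n x :
  x \in hchains H n ->
  simplicial_inclusion G (assoc_complexS HL) n x \in hchains L n.
Proof.
move=> /formalP xH; apply/formalP => s sL; apply: xH; apply: contra sL.
by rewrite !inE => /andP[/(subsetP HL)-> ->].
Qed.

Definition emb_inclusion H L (HL : H \subset L) : chainMap (embInf H) (embInf L) :=
  inf_map (emb_inclusion_subproof HL).

Definition emb_map H L (HL : H \subset L) n :
    {additive embHomology H n -> embHomology L n} :=
  homology_map (emb_inclusion HL) n.

Section MayerVietoris.
Variables (H H' : hypergraph V) (n : nat).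

(* The sign is put on the second component. *)
Definition mv_diag_fun (x : embHomology (hgI H H') n) :
    (embHomology H n * embHomology H' n)%type :=
  (emb_map (subsetIl H H' : hgI H H' \subset H) n x,
   - emb_map (subsetIr H H' : hgI H H' \subset H') n x).

Fact mv_diag_fun_zmod_morphism : zmod_morphism mv_diag_fun.
Proof. by move=> x y; rewrite /mv_diag_fun !raddfB. Qed.

HB.instance Definition _ := GRing.isZmodMorphism.Build
  (embHomology (hgI H H') n) (embHomology H n * embHomology H' n)%type
  mv_diag_fun mv_diag_fun_zmod_morphism.

Definition mv_diag : {additive embHomology (hgI H H') n ->
    (embHomology H n * embHomology H' n)%type} := mv_diag_fun.

Definition mv_sum_fun (x : (embHomology H n * embHomology H' n)%type) :
    embHomology (hgU H H') n :=
  emb_map (subsetUl H H' : H \subset hgU H H') n x.1 +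
  emb_map (subsetUr H H' : H' \subset hgU H H') n x.2.

Fact mv_sum_fun_zmod_morphism : zmod_morphism mv_sum_fun.
Proof. by move=> x y; rewrite /mv_sum_fun !raddfB opprD addrACA. Qed.

HB.instance Definition _ := GRing.isZmodMorphism.Build
  (embHomology H n * embHomology H' n)%type (embHomology (hgU H H') n)
  mv_sum_fun mv_sum_fun_zmod_morphism.

Definition mv_sum : {additive (embHomology H n * embHomology H' n)%type ->
    embHomology (hgU H H') n} := mv_sum_fun.
End MayerVietoris.
End EmbeddedHomology.

(* Main.v *)
(* In positive degree n the infimum complex of H consists of the chains c in
   G(H_n) with boundary in G(H_{n-1}). The point is that Inf(H) + Inf(H')
   fills Inf(H u H'): split a chain c of Inf(H u H') as a + b, with a the part
   on H and b the part on H' \ H. If a face t of s in H, with t not in H,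
   survived in the boundary of a, then t is not in H' (else t = s n t would
   lie in H), so t does not occur in the boundary of c and must be cancelled
   by a face of some s' in H' \ H; then s n s' = t by cardinality, so t is in
   H after all. Hence 0 -> Inf(H n H') -> Inf(H) + Inf(H') -> Inf(H u H') -> 0
   is exact, and its long exact sequence is the one wanted. *)

Require Import Defs.
From mathcomp Require Import all_boot all_order all_algebra.
From HB Require Import structures.
From mathcomp Require Import boolp.
Local Open Scope ring_scope.

Set Implicit Arguments.
Unset Strict Implicit.
Unset Printing Implicit Defensive.

Import GRing.Theory.

(** * Homology classes of cycles *)

Section HomologyClass.
Variables (C : chainComplex) (n : nat).
Implicit Types z w : cycles C n.

Lemma homology_classP (x : homology C n) : exists z, homology_class z = x.
Proof. by exists (repr x); rewrite /homology_class reprK. Qed.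

Lemma homology_classB z w :
  homology_class (z - w) = homology_class z - homology_class w.
Proof. by rewrite /homology_class raddfB. Qed.

Lemma homology_classD z w :
  homology_class (z + w) = homology_class z + homology_class w.
Proof. by rewrite /homology_class raddfD. Qed.

Lemma homology_classN z : homology_class (- z) = - homology_class z.
Proof. by rewrite /homology_class raddfN. Qed.

Lemma homology_class_eq0 z :
  homology_class z = 0 <-> exists y, diff C n y = val z.
Proof.
have -> : (0 : homology C n) = homology_class 0 by rewrite /homology_class raddf0.
split=> [/eqP|zP].
  by rewrite -Quotient.idealrBE subr0 unfold_in /= => /asboolP.
apply/eqP; rewrite -Quotient.idealrBE subr0 unfold_in /=.
exact/asboolP.
Qed.

Lemma homology_class_eq z w y :
  val z - val w = diff C n y -> homology_class z = homology_class w.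
Proof.
move=> zw; apply/eqP; rewrite -subr_eq0 -homology_classB; apply/eqP.
by apply/homology_class_eq0; exists y; rewrite -zw raddfB.
Qed.

Lemma diff_cycle (y : C n.+1) : diff C n y \in @cycle_pred C n.
Proof. by case: n y => [|m] y; rewrite unfold_in //= diffK. Qed.

End HomologyClass.

(** * The long exact sequence of a short exact sequence of chain complexes *)

Section MayerVietorisSequence.
Variables (A B B' D : chainComplex).
Variables (i : chainMap A B) (i' : chainMap A B').
Variables (j : chainMap B D) (j' : chainMap B' D).
Hypothesis i_inj : forall n x, i n x = 0 -> x = 0.
Hypothesis ji : forall n x, j n (i n x) = j' n (i' n x).
Hypothesis exact_mid : forall n b b', j n b + j' n b' = 0 ->
  exists a, i n a = b /\ - i' n a = b'.
Hypothesis sum_surj : forall n z, exists b b', j n b + j' n b' = z.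

Lemma cycle_reflect n (a : A n) :
  i n a \in @cycle_pred B n -> a \in @cycle_pred A n.
Proof.
case: n a => [//|n] a; rewrite !unfold_in /= => /eqP da.
by apply/eqP/i_inj; rewrite chain_mapE.
Qed.

(* The zigzag of the snake lemma, as a relation between cycles. *)
Definition zigzag n (z : D n.+1) (a : A n) : Prop :=
  exists b b', [/\ j n.+1 b + j' n.+1 b' = z, i n a = diff B n b &
                   - i' n a = diff B' n b'].

Lemma zigzagB n (z w : D n.+1) (a e : A n) :
  zigzag z a -> zigzag w e -> zigzag (z - w) (a - e).
Proof.
move=> [b [b' [<- ia i'a]]] [c [c' [<- ie i'e]]].
exists (b - c), (b' - c'); split; rewrite ?raddfB ?ia ?ie //.
  by rewrite opprD addrACA.
by rewrite -i'a -i'e.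
Qed.

Lemma zigzag_cycle n (z : D n.+1) (a : A n) :
  zigzag z a -> a \in @cycle_pred A n.
Proof.
by move=> [b [b' [_ ia _]]]; apply: cycle_reflect; rewrite ia diff_cycle.
Qed.

(** Lift [z] to a pair [b], [b']. The boundaries of the pair sum to the boundary of [z], which is 0,
    so exactness in the middle supplies [a]. *)
Lemma zigzag_total n (z : cycles D n.+1) :
  exists a : cycles A n, zigzag (val z) (val a).
Proof.
case: z => z /= zC; have /eqP dz : diff D n z == 0 := zC.
have [b [b' zE]] := sum_surj z.
have [|a [ia i'a]] := @exact_mid n (diff B n b) (diff B' n b').
  by rewrite !chain_mapE -raddfD zE.
have za : zigzag z a by exists b, b'.
by exists (Subgroup (zigzag_cycle za : a \in (@cycle_pred A n : zmodClosed _))).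
Qed.

(** Lift [y] to [c], [c'] and subtract their boundaries from [b], [b']. The corrected pair sums to
    0, so it comes from some [u]; as the correction is killed by [diff], [u] has boundary [a] by
    injectivity of [i]. *)
Lemma zigzag_boundary n (y : D n.+2) (a : A n) :
  zigzag (diff D n.+1 y) a -> exists u, diff A n u = a.
Proof.
move=> [b [b' [bE ia i'a]]]; have [c [c' yE]] := sum_surj y.
have [|u [iu i'u]] :=
    @exact_mid n.+1 (b - diff B n.+1 c) (b' - diff B' n.+1 c').
  by rewrite !raddfB !chain_mapE addrACA -opprD -raddfD yE bE subrr.
exists u; apply/eqP; rewrite -subr_eq0; apply/eqP/i_inj.
by rewrite raddfB chain_mapE iu raddfB diffK subr0 ia subrr.
Qed.

Definition connecting_fun n (x : homology D n.+1) : homology A n :=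
  homology_class (projT1 (cid (zigzag_total (repr x)))).

(** Independence of all choices: the difference of two zigzags over homologous cycles is a zigzag
    over a boundary, so it ends in a boundary. *)
Lemma connectingE n (z : cycles D n.+1) (a : cycles A n) :
  zigzag (val z) (val a) -> connecting_fun (homology_class z) = homology_class a.
Proof.
move=> za; rewrite /connecting_fun; case: cid => e /= ze.
have : homology_class (repr (homology_class z) - z) = 0.
  by rewrite homology_classB /homology_class reprK subrr.
move/homology_class_eq0 => [y yE].
have /zigzag_boundary[u uE] : zigzag (diff D n.+1 y) (val (e - a)).
  by rewrite yE; apply: zigzagB ze za.
exact: (homology_class_eq (esym uE)).
Qed.

Fact connecting_fun_zmod_morphism n : zmod_morphism (@connecting_fun n).
Proof.
move=> x y; have [z <-] := homology_classP x; have [w <-] := homology_classP y.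
have [a za] := zigzag_total z; have [e we] := zigzag_total w.
rewrite -homology_classB (connectingE za) (connectingE we) -homology_classB.
by apply: connectingE; apply: zigzagB za we.
Qed.

HB.instance Definition _ n := GRing.isZmodMorphism.Build
  (homology D n.+1) (homology A n) (@connecting_fun n)
  (@connecting_fun_zmod_morphism n).

Definition connecting n : {additive homology D n.+1 -> homology A n} :=
  @connecting_fun n.

(** For the inclusions of infimum complexes, [diag] and [sum] are convertible to [mv_diag] and
    [mv_sum], so the exactness results below transfer as they are. *)
Let diag n (x : homology A n) : homology B n * homology B' n :=
  (homology_map i n x, - homology_map i' n x).

Let sum n (y : homology B n * homology B' n) : homology D n :=
  homology_map j n y.1 + homology_map j' n y.2.

Lemma sum_class n (b : cycles B n) (b' : cycles B' n) :
  sum (homology_class b, homology_class b') =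
  homology_class (Defs.cycle_map j n b + Defs.cycle_map j' n b').
Proof. by rewrite /sum /= !homology_mapE homology_classD. Qed.

Lemma diag_class n (a : cycles A n) :
  diag (homology_class a) =
  (homology_class (Defs.cycle_map i n a), homology_class (- Defs.cycle_map i' n a)).
Proof. by rewrite /diag /= !homology_mapE homology_classN. Qed.

Lemma exact_diag_sum n : exact_at (@diag n) (@sum n).
Proof.
case=> x x'; have [b <-] := homology_classP x; have [b' <-] := homology_classP x'.
split=> [|[y]]; last first.
  have [a <-] := homology_classP y; rewrite diag_class => -[<- <-].
  rewrite sum_class; apply/homology_class_eq0; exists 0.
  by rewrite raddf0 /= !raddfN /= ji subrr.
rewrite sum_class => /homology_class_eq0[y yE].
(* Subtracting the boundaries of a lift of [y] keeps the classes of [b] and [b'] and makes their sum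
   vanish already on chains. *)
have [c [c' ycE]] := sum_surj y.
have [|a [ia i'a]] :=
    @exact_mid n (val b - diff B n c) (val b' - diff B' n c').
  by rewrite !raddfB !chain_mapE addrACA -opprD -raddfD ycE yE subrr.
have aC : a \in (@cycle_pred A n : zmodClosed _).
  by apply: cycle_reflect; rewrite ia rpredB ?diff_cycle ?(valP b).
exists (homology_class (Subgroup aC)); rewrite diag_class; congr pair.
  apply: (homology_class_eq (y := - c)).
  by rewrite /= ia raddfN addrAC subrr add0r.
apply: (homology_class_eq (y := - c')).
by rewrite /= i'a raddfN addrAC subrr add0r.
Qed.

Lemma exact_sum_connecting n : exact_at (@sum n.+1) (@connecting n).
Proof.
move=> x; have [z <-] := homology_classP x; split=> [|[[y y']]]; last first.
  have [b <-] := homology_classP y; have [b' <-] := homology_classP y'.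
  (* A sum of two cycles is lifted by these cycles, whose boundaries are 0, so the zigzag ends at
     0. *)
  rewrite sum_class => <-; rewrite [connecting _ _](connectingE (a := 0)).
    by apply/homology_class_eq0; exists 0; rewrite !raddf0.
  have /eqP db : diff B n (val b) == 0 := valP b.
  have /eqP db' : diff B' n (val b') == 0 := valP b'.
  by exists (val b), (val b'); split; rewrite ?db ?db' ?raddf0 ?oppr0.
have [a za] := zigzag_total z; rewrite [connecting _ _](connectingE za).
move=> /homology_class_eq0[u uE]; case: za => b [b' [zE ia i'a]].
(* Since [u] bounds [a], the opposite corrections by its two images turn [b] and [b'] into cycles;
   they cancel in the sum by [ji]. *)
have bC : b - i n.+1 u \in (@cycle_pred B n.+1 : zmodClosed _).
  by rewrite unfold_in /= raddfB -chain_mapE uE ia subrr.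
have bC' : b' + i' n.+1 u \in (@cycle_pred B' n.+1 : zmodClosed _).
  by rewrite unfold_in /= raddfD -chain_mapE uE -i'a addNr.
exists (homology_class (Subgroup bC), homology_class (Subgroup bC')).
rewrite sum_class; congr homology_class; apply: val_inj.
by rewrite /= raddfB raddfD addrACA ji addNr addr0.
Qed.

(** The chains [b], [b'] of a zigzag ending at [a] are exactly chains bounding the two components of
    the image of [a]. *)
Lemma exact_connecting_diag n : exact_at (@connecting n) (@diag n).
Proof.
move=> x; have [a <-] := homology_classP x; rewrite diag_class.
split=> [[/homology_class_eq0[b bE] /homology_class_eq0[b' bE']]|[y]].
  have zC : j n.+1 b + j' n.+1 b' \in (@cycle_pred D n.+1 : zmodClosed _).
    by rewrite unfold_in /= raddfD -!chain_mapE bE bE' /= raddfN /= ji subrr.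
  exists (homology_class (Subgroup zC)); apply: connectingE.
  by exists b, b'; rewrite bE bE'.
have [z <-] := homology_classP y; have [e ze] := zigzag_total z.
rewrite [connecting _ _](connectingE ze) => eqa.
have : diag (homology_class e) = 0.
  rewrite diag_class; case: ze => b [b' [_ ie i'e]]; congr pair.
    by apply/homology_class_eq0; exists b.
  by apply/homology_class_eq0; exists b'.
by rewrite eqa diag_class.
Qed.

(** In degree 0 every chain is a cycle, so surjectivity passes from chains to classes. *)
Lemma sum_surj0 (y : homology D 0) : exists x, sum x = y.
Proof.
have [z <-] := homology_classP y; have [b [b' zE]] := sum_surj (val z).
have bC : b \in (@cycle_pred B 0 : zmodClosed _) by [].
have bC' : b' \in (@cycle_pred B' 0 : zmodClosed _) by [].
exists (homology_class (Subgroup bC), homology_class (Subgroup bC')).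
by rewrite sum_class; congr homology_class; apply: val_inj.
Qed.

End MayerVietorisSequence.

(** * An explicit description of the infimum complex *)

Section InfimumElements.
Variables (C : chainComplex) (D : gradedSubgroup C).

(* The largest subcomplex of C contained in D. *)
Definition inf_max_pred n : {pred C n} :=
  match n return pred (C n) with
  | 0%N => fun x => x \in D 0
  | m.+1 => fun x => (x \in D m.+1) && (diff C m x \in D m)
  end.

Fact inf_max_zmod_closed n : zmod_closed (@inf_max_pred n).
Proof.
case: n => [|n].
  split=> [|x y]; first exact: (rpred0 (D 0)).
  exact: (@rpredB _ (D 0)).
have inE x : (x \in @inf_max_pred n.+1) =
  (x \in D n.+1) && (diff C n x \in D n) by [].
split=> [|x y]; rewrite !inE ?raddf0 ?rpred0 //.
by rewrite raddfB => /andP[? ?] /andP[? ?]; rewrite !rpredB.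
Qed.

HB.instance Definition _ n :=
  GRing.isZmodClosed.Build (C n) (@inf_max_pred n) (@inf_max_zmod_closed n).

Definition inf_max : gradedSubgroup C := fun n => @inf_max_pred n.

Lemma inf_max0 x : (x \in inf_max 0) = (x \in D 0). Proof. by []. Qed.

Lemma inf_maxS n x :
  (x \in inf_max n.+1) = (x \in D n.+1) && (diff C n x \in D n).
Proof. by []. Qed.

(** [inf_max] is itself a subcomplex inside [D], because [diff] squares to 0, so its elements are
    one-term sums. Conversely it contains every such subcomplex and is closed under sums. *)
Lemma infimumE n x : (x \in infimum D n) = (x \in inf_max n).
Proof.
apply/idP/idP => [|xE]; last first.
  rewrite unfold_in /=; apply/asboolP; exists [:: x]; last by rewrite big_seq1.
  move=> y; rewrite inE => /eqP->; exists inf_max; split=> //.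
    move=> [|m] z; rewrite inf_maxS => /andP[_ dz] //.
    by rewrite inf_maxS dz diffK rpred0.
  by move=> [|m] z //; rewrite inf_maxS => /andP[].
rewrite unfold_in /= => /asboolP[s sP ->].
rewrite big_seq; apply: rpred_sum => y /sP[E [Esub ED yE]].
by case: n y yE {x s sP} => [|n] y yE; rewrite ?inf_maxS ?inf_max0 !ED ?Esub.
Qed.

End InfimumElements.

(** * Splitting and intersecting chains of hypergraphs *)

Section EmbeddedChains.
Variables (d : Order.disp_t) (V : finOrderType d) (G : zmodType).
Implicit Types (H : hypergraph V) (c : {ffun {set V} -> G}).

(** Membership in the infimum complex, stated on functions on all of [{set V}] so that chains of
    different hypergraphs can be compared. Degree 0 carries no boundary condition, since [bd] would
    produce the empty face there. *)
Definition emb_chain H n c : bool :=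
  (c \in formal_closed G (nhyperedges H n)) &&
  (if n is m.+1 then bd V G c \in formal_closed G (nhyperedges H m) else true).

Lemma emb_chain_val H n (x : embInf G H n) : emb_chain H n (val (val x)).
Proof.
have := valP x; rewrite infimumE.
case: n x => [|n] x xI; apply/andP; first by split.
by case/andP: xI; split.
Qed.

Lemma emb_chain_lift H n c : emb_chain H n c ->
  exists x : embInf G H n, val (val x) = c.
Proof.
move=> /andP[cH dcH].
have cK : c \in formal_closed G (nhyperedges (assoc_complex H) n).
  apply/formalP => s sK; apply: (formalP _ _ cH); apply: contra sK.
  rewrite [s \in _]inE => /andP[/(subsetP (hyperedges_assoc H)) sK sn].
  by rewrite inE sK.
pose y : simplicialChains G (assoc_complex H) n := Subgroup cK.
have yI : y \in infimum (hchains G H) n.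
  rewrite infimumE; case: n c cH dcH cK @y => [|n] c cH dcH cK y //.
  by rewrite inf_maxS; apply/andP.
by exists (Subgroup yI).
Qed.

Lemma bd_neq0 c (t : {set V}) : bd V G c t != 0 ->
  exists s : {set V}, [/\ c s != 0, t \subset s & #|s| = #|t|.+1].
Proof.
move=> bct; apply/not_existsP => cN; case/negP: bct; apply/eqP.
rewrite /bd /= /bd_fun sum_ffunE big1 // => s _.
rewrite sum_ffunE big1 // => v vs; rewrite ffunE.
case: eqP => // ts; have [->|cs] := eqVneq (c s) 0; first by rewrite mul0rz.
by case: (cN s); split; rewrite // ts ?subsetDl // (cardsD1 v s) vs.
Qed.

Definition faces_shared H L := forall s t : {set V}, s \in hyperedges H ->
  t \in hyperedges L -> s :&: t = set0 \/ s :&: t \in hyperedges (hgI H L).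

Lemma faces_sharedC H L : faces_shared H L -> faces_shared L H.
Proof.
move=> HL s t sL tH; rewrite setIC.
by case: (HL t s tH sL) => [|tsI]; [left|right]; rewrite // inE andbC -in_setI.
Qed.

(** Phrased symmetrically, with disjoint supports as the only link between [a] and [b], so that it
    serves both halves of a splitting. *)
Lemma bd_summand H L n (a b : {ffun {set V} -> G}) : faces_shared H L ->
  a \in formal_closed G (nhyperedges H n.+1) ->
  b \in formal_closed G (nhyperedges L n.+1) ->
  (forall s, a s = 0 \/ b s = 0) ->
  bd V G (a + b) \in formal_closed G (nhyperedges (hgU H L) n) ->
  bd V G a \in formal_closed G (nhyperedges H n).
Proof.
move=> HL /formalP aH /formalP bL ab /formalP dab.
apply/formalP => t tH; apply/eqP/negPn/negP => dat.
have [s [as0 ts st]] := bd_neq0 dat.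
have : s \in nhyperedges H n.+1 by apply: contraNT as0 => /aH->.
rewrite inE => /andP[sH /eqP sn].
have tn : #|t| = n.+1 by move: st; rewrite sn => -[].
have t0 : t != set0 by rewrite -card_gt0 tn.
have {}tH : t \notin hyperedges H by move: tH; rewrite inE tn eqxx andbT.
have shared u : u \in hyperedges L -> s :&: u = t -> False.
  move=> uL sut; case: (HL s u sH uL); rewrite sut; first by apply/eqP.
  by rewrite inE (negPf tH).
(* As a face of [s], [t] would be its own intersection with [s]. *)
have tL : t \notin hyperedges L.
  by apply/negP => /shared; apply; apply/setIidPr.
have dabt : bd V G (a + b) t = 0 by apply: dab; rewrite !inE (negPf tH) (negPf tL).
have dbt : bd V G b t != 0.
  apply: contra dat => /eqP dbt; move: dabt.
  by rewrite raddfD ffunE dbt addr0 => ->.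
have [u [bu0 tu ut]] := bd_neq0 dbt.
have : u \in nhyperedges L n.+1 by apply: contraNT bu0 => /bL->.
rewrite inE => /andP[uL /eqP un].
(* [s] and [u] are distinct by disjointness of supports and both have [n.+2] elements, so their
   intersection has at most [n.+1], the size of [t]. *)
apply: (shared u uL); apply/esym/eqP; rewrite eqEcard subsetI ts tu /= tn.
have su : s != u.
  apply/eqP => su; case: (ab s) => /eqP; first by apply/negP.
  by rewrite su; apply/negP.
rewrite -ltnS -sn; apply: proper_card; rewrite properEneq subsetIl andbT.
apply: contra su => /eqP/setIidPl su.
by rewrite eqEcard su sn un leqnn.
Qed.

Lemma emb_chain_split H L n c : faces_shared H L ->
  emb_chain (hgU H L) n c ->
  exists a b, [/\ emb_chain H n a, emb_chain L n b & a + b = c].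
Proof.
move=> HL /andP[/formalP cU dcU].
(* Hyperedges common to [H] and [L] all go to [a], which keeps the supports disjoint. *)
pose a : {ffun {set V} -> G} := [ffun s => if s \in hyperedges H then c s else 0].
pose b : {ffun {set V} -> G} := [ffun s => if s \in hyperedges H then 0 else c s].
have ab : a + b = c.
  by apply/ffunP => s; rewrite !ffunE; case: ifP; rewrite ?addr0 ?add0r.
have disj s : a s = 0 \/ b s = 0.
  by rewrite !ffunE; case: ifP; [right|left].
have aH : a \in formal_closed G (nhyperedges H n).
  apply/formalP => s; rewrite ffunE inE; case: ifP => //= sH sn.
  by apply: cU; rewrite !inE sH.
have bL : b \in formal_closed G (nhyperedges L n).
  apply/formalP => s; rewrite ffunE inE; case: ifP => //= sH sn.
  by apply: cU; rewrite !inE sH.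
exists a, b; split=> //; rewrite /emb_chain ?aH ?bL /=.
  by case: n {cU} dcU aH bL => // n dcU aH bL; apply: (bd_summand HL aH bL); rewrite ?ab.
case: n {cU} dcU aH bL => // n dcU aH bL.
apply: (bd_summand (faces_sharedC HL) bL aH) => [s|].
  by case: (disj s); [right|left].
rewrite addrC ab; apply/formalP => s sU; apply: (formalP _ _ dcU).
by apply: contra sU; rewrite !inE orbC.
Qed.

Lemma emb_chainI H L n c :
  emb_chain H n c -> emb_chain L n c -> emb_chain (hgI H L) n c.
Proof.
have formalI m (e : {ffun {set V} -> G}) : e \in formal_closed G (nhyperedges H m) ->
    e \in formal_closed G (nhyperedges L m) ->
    e \in formal_closed G (nhyperedges (hgI H L) m).
  move=> /formalP eH /formalP eL; apply/formalP => s; rewrite !inE.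
  move=> /nandP[/nandP[]|] sN.
  - by apply: eH; rewrite inE (negPf sN).
  - by apply: eL; rewrite inE (negPf sN).
  - by apply: eH; rewrite inE (negPf sN) andbF.
move=> /andP[cH dcH] /andP[cL dcL]; rewrite /emb_chain formalI //.
by case: n dcH dcL {cH cL} => // n; apply: formalI.
Qed.

End EmbeddedChains.

(** * The Mayer-Vietoris sequence of embedded homology *)

Theorem theorem3p10 (d : Order.disp_t) (V : finOrderType d) (G : zmodType)
    (H H' : hypergraph V)
    (HH' : forall s s' : {set V}, s \in hyperedges H -> s' \in hyperedges H' ->
       s :&: s' = set0 \/ s :&: s' \in hyperedges (hgI H H')) :
  exists delta : forall n,
      {additive embHomology G (hgU H H') n.+1 -> embHomology G (hgI H H') n},
    (forall n,
       [/\ exact_at (mv_diag G H H' n) (mv_sum G H H' n),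
           exact_at (mv_sum G H H' n.+1) (delta n) &
           exact_at (delta n) (mv_diag G H H' n)])
    /\ (forall y, exists x, mv_sum G H H' 0%N x = y).
Proof.
pose i := emb_inclusion G (subsetIl H H' : hgI H H' \subset H).
pose i' := emb_inclusion G (subsetIr H H' : hgI H H' \subset H').
pose j := emb_inclusion G (subsetUl H H' : H \subset hgU H H').
pose j' := emb_inclusion G (subsetUr H H' : H' \subset hgU H H').
(* All four inclusions are the identity on underlying functions, so equations are checked after two
   [val]. *)
have i_inj n x : i n x = 0 -> x = 0.
  by move=> ix0; do 2!apply: val_inj; apply: (congr1 (fun y => val (val y)) ix0).
have ji n x : j n (i n x) = j' n (i' n x) by do 2!apply: val_inj.
have exact_mid n b b' : j n b + j' n b' = 0 ->
    exists a, i n a = b /\ - i' n a = b'.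
  move=> bb'0.
  have {}bb'0 : val (val b) + val (val b') = 0.
    exact: (congr1 (fun y => val (val y)) bb'0).
  (* [b] and [- b'] are the same function, which thus lies in both infimum complexes and hence in
     that of the intersection. *)
  have b'E : val (val b) = val (val (- b')).
    by apply/eqP; rewrite -addr_eq0 bb'0.
  have [|a aE] := @emb_chain_lift _ V G (hgI H H') n (val (val b)).
    by apply: emb_chainI; [|rewrite b'E]; apply: emb_chain_val.
  exists a; split; first by do 2!apply: val_inj.
  apply/eqP; rewrite eqr_oppLR; apply/eqP; do 2!apply: val_inj.
  by rewrite -b'E.
have sum_surj n z : exists b b', j n b + j' n b' = z.
  have [a [b [/emb_chain_lift[x xE] /emb_chain_lift[y yE] ab]]] :=
    emb_chain_split HH' (emb_chain_val z).
  exists x, y; do 2!apply: val_inj.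
  by rewrite -ab -xE -yE.
exists (connecting i_inj exact_mid sum_surj); split=> [n|].
  split.
  - exact: exact_diag_sum i_inj ji exact_mid sum_surj n.
  - exact: exact_sum_connecting.
  - exact: exact_connecting_diag.
exact: sum_surj0 sum_surj.
Qed.
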